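(* Let $\varphi\colon\mathbb{Z}_+\to\mathbb{R}_+$ be a normalized nondecreasing concave function, let $E$ be a finite set, let $E_j\subseteq E$, and define $f_j\colon 2^E\to\mathbb{R}_+$ by $f_j(S)=\varphi(|S\cap E_j|)$. Then $\mathcal{CG}(f_j)\ge\alpha_\varphi$, where $\alpha_\varphi$ is the Poisson concavity ratio of $\varphi$.
   Context: $\varphi\colon\mathbb{Z}_+\to\mathbb{R}_+$ is normalized nondecreasing concave if $\varphi(0)=0$, $\varphi(1)=1$, $\varphi(i+1)\ge\varphi(i)$ and $\varphi(i+1)-\varphi(i)\ge\varphi(i+2)-\varphi(i+1)$ for all $i\in\mathbb{Z}_+$. Its concave extension $\hat\varphi\colon\mathbb{R}_+\to\mathbb{R}_+$ is $\hat\varphi(\lambda)=\varphi(\lfloor\lambda\rfloor)+(\varphi(\lfloor\lambda\rfloor+1)-\varphi(\lfloor\lambda\rfloor))(\lambda-\lfloor\lambda\rfloor)$. The Poisson concavity ratio of $\varphi$ is $$\alpha_\varphi=\inf_{\lambda\in\mathbb{R}_+}\frac{\mathbb{E}[\varphi(\mathrm{Poi}(\lambda))]}{\hat\varphi(\lambda)},$$ where $\mathrm{Poi}(\lambda)$ is a Poisson random variable with parameter $\lambda$, and $0/0=1$. For $f\colon 2^E\to\mathbb{R}_+$ and $x\in[0,1]^E$, the multilinear extension is $F(x)=\sum_{S\subseteq E}f(S)\prod_{i\in S}x_i\prod_{i\notin S}(1-x_i)$, and the concave extension is $\hat f(x)=\max\{\sum_{S\subseteq E}\lambda_S f(S): \sum_{S\ni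 i}\lambda_S=x_i\ \forall i\in E,\ \sum_{S\subseteq E}\lambda_S=1,\ \lambda\ge0\}$. The correlation gap of $f$ is $\mathcal{CG}(f)=\inf_{x\in[0,1]^E}F(x)/\hat f(x)$, with the convention $0/0=1$. *)

(* Defs.v *)
From HB Require Import structures.
From mathcomp Require Import all_boot all_order all_algebra.
From mathcomp Require Import all_classical all_reals all_analysis.

Set Implicit Arguments.
Unset Strict Implicit.
Unset Printing Implicit Defensive.

Import Order.TTheory GRing.Theory Num.Theory.
Import numFieldNormedType.Exports.

Local Open Scope classical_set_scope.
Local Open Scope ring_scope.

(* [0 / 0 = 1]; for [a > 0] the library's extended division gives
   [a / 0 = +oo]. *)
Definition ratio {R : realType} (a b : \bar R) : \bar R :=
  (if (a == 0) && (b == 0) then 1 else a / b)%E.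

Definition normalized_nondecreasing_concave {R : realType} (phi : nat -> R) :=
  [/\ forall i, 0 <= phi i,
      phi 0%N = 0,
      phi 1%N = 1,
      forall i, phi i <= phi i.+1 &
      forall i, phi i.+2 - phi i.+1 <= phi i.+1 - phi i].

Definition nat_concave_ext {R : realType} (phi : nat -> R) (lambda : R) : R :=
  let k := Num.truncn lambda in
  phi k + (phi k.+1 - phi k) * (lambda - k%:R).

(* The second argument of [poisson_prob] is a dummy that its definition ignores;
   at rate [0] the measure is the Dirac mass at [0]. *)
Definition poisson_concavity_ratio {R : realType} (phi : nat -> R) : \bar R :=
  ereal_inf [set ratio 'E_(poisson_prob lambda 0)[phi]
                       (nat_concave_ext phi lambda)%:E
            | lambda in [set lambda : R | 0 <= lambda]].

Definition multilinear_ext {R : realType} {E : finType}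
    (f : {set E} -> R) (x : E -> R) : R :=
  \sum_(S : {set E})
    f S * (\prod_(i in S) x i) * (\prod_(i | i \notin S) (1 - x i)).

Definition convex_decomposition {R : realType} {E : finType}
    (x : E -> R) (w : {set E} -> R) : Prop :=
  [/\ forall i, \sum_(S : {set E} | i \in S) w S = x i,
      \sum_(S : {set E}) w S = 1 &
      forall S, 0 <= w S].

(* For [x] in the unit cube this supremum is a maximum:
   see [concave_ext_max] below. *)
Definition concave_ext {R : realType} {E : finType}
    (f : {set E} -> R) (x : E -> R) : R :=
  sup [set \sum_(S : {set E}) w S * f S | w in convex_decomposition x].

Definition unit_cube {R : realType} {E : finType} : set (E -> R) :=
  [set x | forall i, 0 <= x i <= 1].

Definition correlation_gap {R : realType} {E : finType}
    (f : {set E} -> R) : \bar R :=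
  ereal_inf [set ratio (multilinear_ext f x)%:E (concave_ext f x)%:E
            | x in unit_cube].

Lemma convex_decomposition_nonempty {R : realType} {E : finType} (x : E -> R) :
  unit_cube x -> convex_decomposition x !=set0.
Proof.
move=> x01.
exists (fun S : {set E} => \prod_i (if i \in S then x i else 1 - x i)); split.
- move=> i.
  pose G j := if j == i then 0 else 1 - x j.
  have -> : x i = \prod_j (x j + G j).
    rewrite (bigD1 i)//= /G eqxx addr0 big1 ?mulr1// => j /negbTE ->.
    by rewrite addrC subrK.
  rewrite bigA_distr [RHS](bigID (fun S : {set E} => i \in S))/=.
  rewrite [X in _ = _ + X]big1 ?addr0; last first.
    by move=> S /negbTE iS; rewrite (bigD1 i)//= iS /G eqxx mul0r.
  apply: eq_bigr => S iS; apply: eq_bigr => j _.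
  case: ifPn => // jS; rewrite /G ifN//.
  by apply: contraNneq jS => ->.
- rewrite -[RHS](big1 (op := *%R) (index_enum E) xpredT (fun i => x i + (1 - x i))).
    by rewrite bigA_distr.
  by move=> i _; rewrite addrC subrK.
- move=> S; apply: prodr_ge0 => i _; have /andP[x0 x1] := x01 i.
  by case: ifP; rewrite // subr_ge0.
Qed.

Section attained.
Import ArrowAsProduct.

Let continuous_sum {R : realType} {T : topologicalType} {I : finType}
    (P : pred I) (F : I -> T -> R) : (forall i, continuous (F i)) ->
  continuous (fun t => \sum_(i | P i) F i t).
Proof.
move=> cF; elim: (index_enum I) => [|i r IH] t.
  by under eq_fun do rewrite big_nil; exact: cst_continuous.
under eq_fun do rewrite big_cons; case: (P i) => /=.
  by apply: cvgD; [exact: cF|exact: IH].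
exact: IH.
Qed.

Let convex_decomposition_compact {R : realType} {E : finType} (x : E -> R) :
  compact (convex_decomposition x : set ({set E} -> R)).
Proof.
have cp (S : {set E}) : continuous (fun w : {set E} -> R => w S).
  exact: (@proj_continuous _ (fun=> R) S).
have cE : closed (convex_decomposition x : set ({set E} -> R)).
  have -> : convex_decomposition x =
      \bigcap_(i in [set: E]) [set w | \sum_(S : {set E} | i \in S) w S = x i]
      `&` ([set w | \sum_(S : {set E}) w S = 1]
      `&` \bigcap_(S in [set: {set E}]) [set w | 0 <= w S]).
    apply/seteqP; split => w /=.
      by case=> h1 h2 h3; split=> [i _|]; [exact: h1|split=> // S _; exact: h3].
    by case=> h1 [h2 h3]; split=> [i||S]; [exact: h1| |exact: h3].
  apply: closedI; [|apply: closedI].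
  - apply: closed_bigI => i _.
    apply: (@preimage_closed _ R (fun w : {set E} -> R =>
      \sum_(S : {set E} | i \in S) w S) [set y | y = x i]).
      by move=> w _; apply: continuous_sum.
    exact: closed_eq.
  - apply: (@preimage_closed _ R (fun w : {set E} -> R =>
      \sum_(S : {set E}) w S) [set y | y = 1]).
      by move=> w _; apply: continuous_sum.
    exact: closed_eq.
  - apply: closed_bigI => S _.
    apply: (@preimage_closed _ R (fun w : {set E} -> R => w S) [set y | 0 <= y]).
      by move=> w _; exact: cp.
    exact: closed_ge.
have cube : compact [set w : {set E} -> R | forall S, `[0, 1]%classic (w S)].
  exact: (@tychonoff _ (fun=> R) (fun=> `[0, 1]%classic)
    (fun=> @segment_compact R 0 1)).
apply: (subclosed_compact cE cube).
move=> w [_ w1 w0] S /=; rewrite in_itv/= w0 -w1 (bigD1 S)//= lerDl.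
by apply: sumr_ge0.
Qed.

Lemma concave_ext_max {R : realType} {E : finType}
    (f : {set E} -> R) (x : E -> R) : unit_cube x ->
  exists2 w, convex_decomposition x w &
    concave_ext f x = \sum_(S : {set E}) w S * f S /\
    forall v, convex_decomposition x v ->
      \sum_(S : {set E}) v S * f S <= \sum_(S : {set E}) w S * f S.
Proof.
move=> x01.
have obj_cont : continuous
    (fun w : {set E} -> R => \sum_(S : {set E}) w S * f S).
  apply: continuous_sum => S w.
  exact: cvgM (@proj_continuous _ (fun=> R) S w) (cvg_cst (f S)).
have [w /set_mem xw wmax] := @compact_EVT_max ({set E} -> R) R _ _
    (convex_decomposition_nonempty x01) (@convex_decomposition_compact _ _ x)
    (continuous_subspaceT obj_cont).
have wub v : convex_decomposition x v ->
    \sum_(S : {set E}) v S * f S <= \sum_(S : {set E}) w S * f S.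
  by move=> xv; apply: wmax; rewrite inE.
exists w => //; split => //; apply/eqP; rewrite eq_le; apply/andP; split.
  apply: ge_sup; first by exists (\sum_(S : {set E}) w S * f S), w.
  by move=> _ [v xv <-]; exact: wub.
apply: ub_le_sup; last by exists w.
by exists (\sum_(S : {set E}) w S * f S) => _ [v xv <-]; exact: wub.
Qed.

End attained.

(* Main.v *)
From HB Require Import structures.
Require Import Defs.
From mathcomp Require Import all_boot all_order all_algebra.
From mathcomp Require Import all_classical all_reals all_analysis.
From mathcomp Require Import lra ring.

Set Implicit Arguments.
Unset Strict Implicit.
Unset Printing Implicit Defensive.

Import Order.TTheory GRing.Theory Num.Theory.
Import numFieldNormedType.Exports.

Local Open Scope classical_set_scope.
Local Open Scope ring_scope.

(** For [x] in the unit cube let [l] be the sum of the [x i] over [Ej]. The ratio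
    at [x] in the correlation gap is bounded below by the ratio at the single
    rate [l] in the Poisson concavity ratio, because the numerators and the
    denominators compare separately.

    The concave extension of [f_j] at [x] is at most the concave extension of
    [phi] at [l], by Jensen's inequality ([concave_ext_le]).

    The multilinear extension of [f_j] at [x] is the expectation of [phi] at a sum
    of independent Bernoulli variables of parameters [x i], and it is at least
    the expectation of [phi] at a Poisson variable of the same mean [l]. Indeed a
    Poisson variable of rate [l] is a sum of independent Poisson variables of
    rates [x i], and replacing one of them by a Bernoulli variable of the same
    mean can only increase the expectation of a concave function
    ([poisson_psum_le_bernoulli]). The function obtained by averaging over that
    Bernoulli variable is again concave ([bernoulli_step_concave]), so the
    replacement can be iterated ([poisson_psum_le_pairing]).

    As [phi] is nonnegative, it is enough to bound every partial sum of the
    Poisson expectation, so that the whole comparison takes place between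
    finite sums; generating polynomials keep track of the Bernoulli sums. *)

(** * Concave sequences and their supporting lines *)

(** Unlike the normalized class, this one is stable under [bernoulli_step],
    which destroys the values at [0] and [1]. *)
Definition nonneg_nondecreasing_concave {R : realType} (psi : nat -> R) :=
  [/\ forall i, 0 <= psi i,
      forall i, psi i <= psi i.+1 &
      forall i, psi i.+2 - psi i.+1 <= psi i.+1 - psi i].

Lemma concave_increments {R : realType} (psi : nat -> R) i j :
  nonneg_nondecreasing_concave psi -> (i <= j)%N ->
  psi j.+1 - psi j <= psi i.+1 - psi i.
Proof.
move=> [_ _ dpsi]; elim: j => [|j IH]; first by rewrite leqn0 => /eqP ->.
rewrite leq_eqVlt => /predU1P[-> //|]; rewrite ltnS => /IH.
exact: le_trans.
Qed.

(** The chord of [psi] on [k, k.+1] has the slope of a supporting line at [k]: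
    to the right of [k] the increments are at most that slope, to the left at
    least. *)
Lemma concave_le_line {R : realType} (psi : nat -> R) k m :
  nonneg_nondecreasing_concave psi ->
  psi m <= psi k + (psi k.+1 - psi k) * (m%:R - k%:R).
Proof.
move=> psiC; have [km|/ltnW mk] := leqP k m.
  rewrite -(subnKC km); elim: (m - k)%N => [|j IH].
    by rewrite addn0 subrr mulr0 addr0.
  have := concave_increments psiC (leq_addr j k).
  rewrite addnS -natr1; move: IH; nra.
rewrite -(subnKC mk); elim: (k - m)%N => [|j IH].
  by rewrite addn0 subrr mulr0 addr0.
have := concave_increments psiC (leqnSn (m + j)).
have : 0 <= j%:R :> R by [].
rewrite addnS -natr1; move: IH; rewrite natrD; nra.
Qed.

(** The conditional expectation of [psi (n + B)] for a Bernoulli variable [B] of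
    parameter [p]. *)
Definition bernoulli_step {R : realType} (p : R) (psi : nat -> R) n : R :=
  (1 - p) * psi n + p * psi n.+1.

Lemma bernoulli_step_concave {R : realType} (p : R) (psi : nat -> R) :
  0 <= p <= 1 -> nonneg_nondecreasing_concave psi ->
  nonneg_nondecreasing_concave (bernoulli_step p psi).
Proof.
move=> p01 [psi0 psi1 psi2]; rewrite /bernoulli_step; split => i.
- by have := psi0 i; have := psi0 i.+1; nra.
- by have := psi1 i; have := psi1 i.+1; nra.
- by have := psi2 i; have := psi2 i.+1; nra.
Qed.

(** * Partial sums of Poisson expectations *)

(** With [0 ^+ 0 = 1] this gives the Dirac mass at [0] for [l = 0], whereas
    [poisson_pmf] is constantly [1] there; so no case distinction on the rate is
    needed in what follows. *)
Definition poisson_weight {R : realType} (l : R) (n : nat) : R :=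
  l ^+ n / n`!%:R * expR (- l).

Definition poisson_psum {R : realType} N (psi : nat -> R) (l : R) : R :=
  \sum_(n < N) poisson_weight l n * psi n.

Section poisson_weight.
Context {R : realType}.
Implicit Types (l p : R) (psi : nat -> R).

Lemma poisson_weight_ge0 l n : 0 <= l -> 0 <= poisson_weight l n.
Proof. by move=> l0; rewrite !mulr_ge0 ?expR_ge0 ?invr_ge0 ?exprn_ge0. Qed.

(** Independent Poisson variables add up: this is the binomial formula. *)
Lemma poisson_weightD l p n : poisson_weight (l + p) n =
  \sum_(j < n.+1) poisson_weight l (n - j) * poisson_weight p j.
Proof.
rewrite /poisson_weight opprD expRD exprDn !mulr_suml.
apply: eq_bigr => -[j /= jn] _; rewrite -mulr_natr.
have nz k : k`!%:R != 0 :> R by rewrite pnatr_eq0 -lt0n fact_gt0.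
have -> : n`!%:R = 'C(n, j)%:R * (j`!%:R * (n - j)`!%:R) :> R.
  by rewrite -!natrM bin_fact.
have bnz : 'C(n, j)%:R != 0 :> R by rewrite pnatr_eq0 -lt0n bin_gt0.
by field; rewrite !nz bnz.
Qed.

Lemma sum_poisson_weight_le1 N l : 0 <= l ->
  \sum_(n < N) poisson_weight l n <= 1.
Proof.
move=> l0; rewrite -mulr_suml expRN ler_pdivrMr ?expR_gt0// mul1r /expR.
have -> : \sum_(n < N) l ^+ n / n`!%:R = series (exp_coeff l) N.
  by rewrite /series/= big_mkord.
apply: nondecreasing_cvgn_le; last exact: is_cvg_series_exp_coeff.
by apply: nondecreasing_series => n _ _; rewrite exp_coeff_ge0.
Qed.

Lemma sum_poisson_weight_mean_le N l : 0 <= l ->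
  \sum_(n < N) poisson_weight l n * n%:R <= l.
Proof.
move=> l0; case: N => [|N]; first by rewrite big_ord0.
rewrite big_ord_recl mulr0 add0r.
rewrite (eq_bigr (fun n : 'I_N => l * poisson_weight l n)); last first.
  move=> n _; rewrite lift0 /poisson_weight factS natrM exprS; field.
  by rewrite pnatr_eq0 -lt0n fact_gt0 addrC natr1 pnatr_eq0.
by rewrite -mulr_sumr ler_piMr ?sum_poisson_weight_le1.
Qed.

Lemma poisson_psum_le N l psi chi : 0 <= l -> (forall n, psi n <= chi n) ->
  poisson_psum N psi l <= poisson_psum N chi l.
Proof.
move=> l0 le; apply: ler_sum => n _.
by rewrite ler_wpM2l ?poisson_weight_ge0.
Qed.

(** The left side sums over the pairs [(k, j)] with [k + j < N], the right side
    over the whole square [k, j < N]; the terms are nonnegative. Only an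
    inequality is required, so truncation replaces any manipulation of double
    series. *)
Lemma poisson_psumD N l p psi : 0 <= l -> 0 <= p -> (forall n, 0 <= psi n) ->
  poisson_psum N psi (l + p)
  <= poisson_psum N (fun n => poisson_psum N (fun j => psi (n + j)%N) p) l.
Proof.
move=> l0 p0 psi0.
pose a k j := poisson_weight l k * poisson_weight p j * psi (k + j)%N.
have a0 k j : 0 <= a k j.
  by apply: mulr_ge0 (psi0 _); apply: mulr_ge0; exact: poisson_weight_ge0.
(* Both sides become sums of [a k j], with the index [j] outermost. *)
have -> : poisson_psum N psi (l + p) =
    \sum_(n < N) \sum_(j < N | (j <= n)%N) a (n - j)%N j.
  apply: eq_bigr => n _.
  rewrite poisson_weightD mulr_suml.
  rewrite (big_ord_widen_cond N xpredT
    (fun j => poisson_weight l (n - j) * poisson_weight p j * psi n)) //=.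
  by apply: eq_big => [j|j]; rewrite ltnS//= => jn; rewrite /a subnK.
have -> : poisson_psum N (fun n => poisson_psum N (fun j => psi (n + j)%N) p) l
    = \sum_(j < N) \sum_(k < N) a k j.
  rewrite exchange_big; apply: eq_bigr => k _; rewrite mulr_sumr.
  by apply: eq_bigr => j _; rewrite mulrA.
rewrite (exchange_big_dep xpredT)//=; apply: ler_sum => j _.
(* For fixed [j], shift [n] to [n - j]: this leaves the range [0 <= k < N - j]. *)
rewrite -(big_mkord (fun n => (j <= n)%N) (fun n => a (n - j)%N j)).
rewrite -(big_mkord xpredT (fun k => a k j)).
rewrite (big_cat_nat (n := j))//=; last exact: ltnW.
rewrite big_nat_cond big1 ?add0r; last by move=> n; case: ltnP; rewrite ?andbF.
rewrite big_mkcond/= -{1}[nat_of_ord j]add0n big_addn.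
rewrite [leRHS](big_cat_nat (n := (N - j)%N))//= ?leq_subr//.
rewrite ler_wpDr ?sumr_ge0//; apply: ler_sum => n _.
by rewrite leq_addl addnK.
Qed.

(** A Poisson variable is larger in the convex order than a Bernoulli variable of
    the same mean: on the integers, [psi (n + _)] lies below the line through
    its values at [0] and [1]. That line has nonnegative value and slope, so it
    suffices that the truncated mass is at most [1] and the truncated mean at
    most [p]. *)
Lemma poisson_psum_le_bernoulli N p psi : 0 <= p ->
  nonneg_nondecreasing_concave psi ->
  forall n, poisson_psum N (fun j => psi (n + j)%N) p <= bernoulli_step p psi n.
Proof.
move=> p0 psiC n; have [psi0 psi1 _] := psiC.
have : poisson_psum N (fun j => psi (n + j)%N) p <=
       poisson_psum N (fun j => psi n + (psi n.+1 - psi n) * j%:R) p.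
  apply: poisson_psum_le => // j.
  by have := concave_le_line n (n + j) psiC; rewrite natrD [n%:R + _]addrC addrK.
move=> /le_trans; apply.
have -> : poisson_psum N (fun j => psi n + (psi n.+1 - psi n) * j%:R) p =
  psi n * (\sum_(j < N) poisson_weight p j)
  + (psi n.+1 - psi n) * (\sum_(j < N) poisson_weight p j * j%:R).
  rewrite !mulr_sumr -big_split/=; apply: eq_bigr => j _; ring.
have := sum_poisson_weight_le1 N p0; have := sum_poisson_weight_mean_le N p0.
have := psi0 n; have := psi1 n; rewrite /bernoulli_step; nra.
Qed.

End poisson_weight.

(** * Sums of independent Bernoulli variables *)

(** The linear functional sending ['X^n] to [psi n]. On the probability
    generating function of an integer variable [B] it gives the expectation of
    [psi B]. *)
Definition coef_pairing {R : realType} (psi : nat -> R) (P : {poly R}) : R :=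
  \sum_(k < size P) P`_k * psi k.

Section coef_pairing.
Context {R : realType}.
Implicit Types (psi : nat -> R) (P Q : {poly R}).

Lemma coef_pairing_widen psi P n : (size P <= n)%N ->
  coef_pairing psi P = \sum_(k < n) P`_k * psi k.
Proof.
move=> Pn; rewrite /coef_pairing.
rewrite (big_ord_widen n (fun k => P`_k * psi k))// [LHS]big_mkcond/=.
by apply: eq_bigr => k _; case: ltnP => // /(nth_default 0) ->; rewrite mul0r.
Qed.

Lemma coef_pairing_is_linear psi : linear (coef_pairing psi : _ -> R^o).
Proof.
move=> a P Q.
pose n := maxn (size (a *: P + Q)) (maxn (size P) (size Q)).
rewrite !(@coef_pairing_widen _ _ n) ?leq_max ?leqnn ?orbT//.
rewrite scaler_sumr -big_split/=; apply: eq_bigr => k _.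
by rewrite coefD coefZ mulrDl -mulrA.
Qed.

HB.instance Definition _ psi := GRing.isLinear.Build R {poly R} R^o _
  (coef_pairing psi) (coef_pairing_is_linear psi).

Lemma coef_pairingXn psi n : coef_pairing psi 'X^n = psi n.
Proof.
rewrite /coef_pairing size_polyXn big_ord_recr/= coefXn eqxx mul1r.
rewrite big1 ?add0r// => k _.
by rewrite coefXn ltn_eqF ?mul0r.
Qed.

Lemma coef_pairingXM psi P :
  coef_pairing psi ('X * P) = coef_pairing (fun n => psi n.+1) P.
Proof.
rewrite (@coef_pairing_widen _ _ (size P).+1); last first.
  by rewrite (leq_trans (size_polyMleq _ _))// size_polyX.
rewrite big_ord_recl coefXM eqxx mul0r add0r.
by apply: eq_bigr => k _; rewrite coefXM.
Qed.

Lemma coef_pairing_bernoulli psi (p : R) P :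
  coef_pairing psi ((p *: 'X + (1 - p)%:P) * P) =
  coef_pairing (bernoulli_step p psi) P.
Proof.
rewrite mulrDl -scalerAl mul_polyC linearD/= !linearZ/= coef_pairingXM.
rewrite /coef_pairing !scaler_sumr -big_split; apply: eq_bigr => k _ /=.
rewrite /bernoulli_step /GRing.scale/=; ring.
Qed.

End coef_pairing.

(** Bernoulli factors are split off one at a time: the induction has to range
    over all [psi], since each step replaces [psi] by [bernoulli_step p psi].
    Nonnegativity of the rate is carried along for the additivity step. *)
Lemma poisson_psum_le_pairing {R : realType} {E : finType} (A : {set E})
    (x : E -> R) N (psi : nat -> R) :
  unit_cube x -> nonneg_nondecreasing_concave psi ->
  poisson_psum N psi (\sum_(i in A) x i)
  <= coef_pairing psi (\prod_(i in A) (x i *: 'X + (1 - x i)%:P)).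
Proof.
move=> x01; move: psi.
have [//] : 0 <= \sum_(i in A) x i /\
  forall psi, nonneg_nondecreasing_concave psi ->
  poisson_psum N psi (\sum_(i in A) x i)
  <= coef_pairing psi (\prod_(i in A) (x i *: 'X + (1 - x i)%:P)).
apply: (big_rec2 (fun (P : {poly R}) (l : R) => 0 <= l /\
  forall psi, nonneg_nondecreasing_concave psi ->
  poisson_psum N psi l <= coef_pairing psi P)).
  split=> // psi [psi0 _ _].
  rewrite -(expr0 'X) coef_pairingXn /poisson_psum.
  case: N => [|N]; first by rewrite big_ord0.
  rewrite big_ord_recl big1 ?addr0; last first.
    by move=> n _; rewrite /poisson_weight expr0n /= !mul0r.
  by rewrite /poisson_weight expr0 fact0 oppr0 expR0 invr1 !mul1r.
move=> i P l _ [l0 IH]; have /andP[p0 p1] := x01 i.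
split=> [|psi psiC]; first exact: addr_ge0.
rewrite coef_pairing_bernoulli addrC; have [psi0 _ _] := psiC.
apply: (le_trans (poisson_psumD N l0 p0 psi0)).
apply: le_trans (IH _ (bernoulli_step_concave (x01 i) psiC)).
by apply: poisson_psum_le => //; exact: poisson_psum_le_bernoulli.
Qed.

(** The multilinear extension is the expectation over a random set containing each
    [i] independently with probability [x i]; the product below is the
    generating function of its number of elements in [A]. *)
Lemma multilinear_ext_pairing {R : realType} {E : finType} (A : {set E})
    (x : E -> R) (psi : nat -> R) :
  multilinear_ext (fun S : {set E} => psi #|S :&: A|) x =
  coef_pairing psi (\prod_(i in A) (x i *: 'X + (1 - x i)%:P)).
Proof.
(* Elements outside [A] contribute the factor [x i + (1 - x i) = 1]. *)
have -> : \prod_(i in A) (x i *: 'X + (1 - x i)%:P) =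
    \prod_i ((x i *: (if i \in A then 'X else 1)) + (1 - x i)%:P) :> {poly R}.
  rewrite big_mkcond; apply: eq_bigr => i _; case: ifP => // _.
  by rewrite alg_polyC -polyCD addrC subrK.
rewrite bigA_distr linear_sum; apply: eq_bigr => S _ /=.
rewrite [\prod_i _ in RHS](bigID (mem S))/=.
have -> : \prod_(i in S) (if i \in S
      then x i *: (if i \in A then 'X else 1) else (1 - x i)%:P) =
    (\prod_(i in S) x i)%:P * 'X^#|S :&: A| :> {poly R}.
  rewrite rmorph_prod -prodr_const/=.
  under [X in _ = _ * X]eq_bigl do rewrite inE.
  rewrite big_mkcondr -big_split/=.
  by apply: eq_bigr => i ->; rewrite mul_polyC.
have -> : \prod_(i | i \notin S) (if i \in S
      then x i *: (if i \in A then 'X else 1) else (1 - x i)%:P) =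
    (\prod_(i | i \notin S) (1 - x i))%:P :> {poly R}.
  by rewrite rmorph_prod; apply: eq_bigr => i /negbTE ->.
rewrite [in RHS]mulrAC -polyCM mul_polyC linearZ/= coef_pairingXn.
by rewrite /GRing.scale/= -mulrA mulrC.
Qed.

(** * The concave extension *)

(** Jensen's inequality: under any convex decomposition of [x] the mean of
    [#|S :&: A|] is the same number [l], and [psi] lies below its supporting line
    at the integer part of [l], whose value at [l] is [nat_concave_ext psi l]. *)
Lemma concave_ext_le {R : realType} {E : finType} (A : {set E})
    (x : E -> R) (psi : nat -> R) :
  unit_cube x -> nonneg_nondecreasing_concave psi ->
  concave_ext (fun S : {set E} => psi #|S :&: A|) x
  <= nat_concave_ext psi (\sum_(i in A) x i).
Proof.
move=> x01 psiC.
have [w [wx w1 w0] [-> _]] := concave_ext_max (fun S : {set E} => psi #|S :&: A|) x01.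
rewrite /nat_concave_ext; set l := \sum_(i in A) x i; set k := Num.truncn l.
have mean : \sum_(S : {set E}) w S * #|S :&: A|%:R = l.
  rewrite /l; under [RHS]eq_bigr do rewrite -wx.
  rewrite (exchange_big_dep xpredT)//=; apply: eq_bigr => S _.
  rewrite sumr_const mulr_natr; congr (_ *+ _); apply: eq_card => i.
  by rewrite !inE andbC.
apply: (@le_trans _ _ (\sum_(S : {set E}) w S *
    (psi k + (psi k.+1 - psi k) * (#|S :&: A|%:R - k%:R)))).
  by apply: ler_sum => S _; rewrite ler_wpM2l// concave_le_line.
have -> : psi k + (psi k.+1 - psi k) * (l - k%:R) =
    (psi k - (psi k.+1 - psi k) * k%:R) * (\sum_(S : {set E}) w S) +
    (psi k.+1 - psi k) * (\sum_(S : {set E}) w S * #|S :&: A|%:R).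
  by rewrite w1 mean; ring.
rewrite !mulr_sumr -big_split/= le_eqVlt; apply/predU1P; left.
by apply: eq_bigr => S _; ring.
Qed.

Lemma concave_ext_ge0 {R : realType} {E : finType} (f : {set E} -> R)
    (x : E -> R) : unit_cube x -> (forall S, 0 <= f S) -> 0 <= concave_ext f x.
Proof.
move=> x01 f0; have [w [_ _ w0] [-> _]] := concave_ext_max f x01.
by apply: sumr_ge0 => S _; rewrite mulr_ge0.
Qed.

(** * The Poisson expectation as a series *)

Lemma poisson_prob_set1 {R : realType} (l : R) (m n : nat) : 0 <= l ->
  poisson_prob l m [set n] = (poisson_weight l n)%:E.
Proof.
rewrite le_eqVlt => /predU1P[<-|l0]; rewrite /poisson_prob.
  rewrite ltxx diracE; congr (_%:E).
  rewrite /poisson_weight oppr0 expR0 mulr1.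
  case: n => [|n]; first by rewrite mem_set// expr0 fact0 invr1 mulr1.
  by rewrite memNset// expr0n/= mul0r.
by rewrite l0 esum_set1 ?lee_fin ?poisson_pmf_ge0// /poisson_pmf l0.
Qed.

Lemma poisson_expectation {R : realType} (l : R) (m : nat) (psi : nat -> R) :
  0 <= l -> (forall n, 0 <= psi n) ->
  'E_(poisson_prob l m)[psi]%E = limn (fun N => (poisson_psum N psi l)%:E).
Proof.
move=> l0 psi0; rewrite unlock.
have -> : [set: nat] = \bigcup_n [set n] by apply/seteqP; split=> // n _; exists n.
rewrite ge0_integral_bigcup//=; last 2 first.
- by move=> n _; rewrite lee_fin.
- by apply/trivIsetP => i j _ _ /eqP ij; apply/seteqP; split=> // n [/= -> /ij].
apply/congr_lim/funext => N; rewrite /poisson_psum -sumEFin big_mkord.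
apply: eq_bigr => n _.
rewrite (@eq_integral _ _ _ _ _ (cst (psi n)%:E)); last first.
  by move=> k; rewrite inE/= => ->.
by rewrite integral_cst//= poisson_prob_set1// muleC.
Qed.

(** * Comparison of the two ratios *)

(** The conventions at [0] are compatible with monotonicity: if [d = 0] the
    right side is [1] or [+oo], and it is [1] only for [c = 0], which forces
    [a = 0]. *)
Lemma le_ratio {R : realType} (a : \bar R) (b c d : R) :
  (0 <= a)%E -> (a <= c%:E)%E -> 0 <= d -> d <= b ->
  (Defs.ratio a b%:E <= Defs.ratio c%:E d%:E)%E.
Proof.
case: a => [a| |]//; rewrite !lee_fin => a0 ac d0 db.
have [d00|dN0] := eqVneq d 0.
  rewrite /Defs.ratio d00 eqxx andbT inve0.
  have [c00|cN0] := eqVneq c 0.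
    have -> : a = 0 by apply/eqP; rewrite eq_le a0 -c00 ac.
    by rewrite c00 eqxx/=; case: ifP; rewrite // mul0e lee_fin.
  have cgt0 : 0 < c by rewrite lt_neqAle eq_sym cN0 (le_trans a0).
  by rewrite [c%:E == 0]eqe (negbTE cN0) gt0_muley ?leey ?lte_fin.
have dgt0 : 0 < d by rewrite lt_neqAle eq_sym dN0.
have bgt0 : 0 < b := lt_le_trans dgt0 db.
rewrite /Defs.ratio !eqe (gt_eqF dgt0) (gt_eqF bgt0) !andbF !inver.
rewrite (gt_eqF dgt0) (gt_eqF bgt0) -!EFinM lee_fin.
by rewrite ler_pM ?lef_pV2 ?invr_ge0// ltW.
Qed.

Theorem proposition3p4 (R : realType) (phi : nat -> R) (E : finType)
    (Ej : {set E}) :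
  normalized_nondecreasing_concave phi ->
  (poisson_concavity_ratio phi
     <= correlation_gap (fun S : {set E} => phi #|S :&: Ej|))%E.
Proof.
move=> [phi0 _ _ phi1 phi2].
have phiC : nonneg_nondecreasing_concave phi by split.
apply: le_ereal_inf_tmp => _ [x x01 <-].
have l0 : 0 <= \sum_(i in Ej) x i.
  by apply: sumr_ge0 => i _; have /andP[] := x01 i.
apply: (@le_trans _ _ (Defs.ratio
    'E_(poisson_prob (\sum_(i in Ej) x i) 0)[phi]
    (nat_concave_ext phi (\sum_(i in Ej) x i))%:E)).
  by apply: ereal_inf_lbound; exists (\sum_(i in Ej) x i).
apply: le_ratio.
- by apply: expectation_ge0 => n; exact: phi0.
- rewrite poisson_expectation//; apply: lime_le.
    apply: ereal_nondecreasing_is_cvgn; apply/nondecreasing_seqP => N.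
    rewrite lee_fin /poisson_psum big_ord_recr/= lerDl.
    by rewrite mulr_ge0 ?poisson_weight_ge0.
  apply: nearW => N; rewrite lee_fin multilinear_ext_pairing.
  exact: poisson_psum_le_pairing.
- exact: concave_ext_ge0.
- exact: concave_ext_le.
Qed.
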